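(* Let $\alpha\in\mathbb{R}$ be irrational of finite type $\eta$, and let $\epsilon=\epsilon_R>0$ be a function of $R>0$ such that $\epsilon\to0$ and $\epsilon R^{1+1/\eta}\to\infty$ as $R\to\infty$. Then, in the limit as $R\to\infty$, $$S_\alpha(\epsilon,R)=\mathrm{Area}(\mathrm{Sect}_{\alpha,\epsilon}(R))+O\left(\epsilon^{\frac{1}{1+\eta}}R+R^2\epsilon^2\right).$$
   Context: An irrational $\alpha\in\mathbb{R}$ is said to be of finite type $\eta$ (a real number) if there exists a constant $c=c(\alpha)>0$ such that $\left|\alpha-\frac pq\right|>\frac{c}{q^{1+\eta}}$ for all pairs $(p,q)\in\mathbb{Z}\times\mathbb{Z}_{>0}$ (necessarily $\eta\ge1$ by Dirichlet's theorem). For $\alpha\in\mathbb{R}$, $\epsilon>0$, $R>0$ define the sector $$\mathrm{Sect}_{\alpha,\epsilon}(R):=\{(x,y)\in\mathbb{R}_{>0}\times\mathbb{R}:\ x^2+y^2\le R^2,\ \alpha-\epsilon<y/x<\alpha+\epsilon\},$$ whose area is $\mathrm{Area}(\mathrm{Sect}_{\alpha,\epsilon}(R))=\frac{R^2}{2}\left(\tan^{-1}(\alpha+\epsilon)-\tan^{-1}(\alpha-\epsilon)\right)$, and let $$S_\alpha(\epsilon,R):=\#\left(\mathbb{Z}^2\cap \mathrm{Sect}_{\alpha,\epsilon}(R)\right)=\#\{(m,n)\in\mathbb{Z}_{>0}\times\mathbb{Z}: m^2+n^2\le R^2,\ |n-\alpha m|<m\epsilon\}.$$ The quantity $\epsilon=\epsilon_R$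 is viewed as a function of $R$. The $O$-notation refers to the limit $R\to\infty$ with $\alpha$, $\eta$ and the function $R\mapsto\epsilon_R$ fixed: the bound holds for all sufficiently large $R$ with an implied constant not depending on $R$. *)

(* Defs.v *)
From HB Require Import structures.
From mathcomp Require Import all_boot all_order all_algebra finmap.
From mathcomp Require Import all_classical all_reals all_analysis.
Set Implicit Arguments.
Unset Strict Implicit.
Unset Printing Implicit Defensive.
Import Order.TTheory GRing.Theory Num.Theory.
Import numFieldNormedType.Exports.

Local Open Scope classical_set_scope.
Local Open Scope ring_scope.

Definition finite_type (R : realType) (alpha eta : R) : Prop :=
  exists2 c : R, 0 < c &
    forall p q : int, 0 < q ->
      `|alpha - p%:~R / q%:~R| > c / (q%:~R `^ (1 + eta)).

Definition Sect (R : realType) (alpha eps r : R) : set (R * R) :=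
  [set z | [/\ 0 < z.1, z.1 ^+ 2 + z.2 ^+ 2 <= r ^+ 2,
               alpha - eps < z.2 / z.1 & z.2 / z.1 < alpha + eps]].

(* The sector is bounded, so [fine] does not truncate. *)
Definition area_Sect (R : realType) (alpha eps r : R) : R :=
  fine ((@lebesgue_measure R \x @lebesgue_measure R)%E (Sect alpha eps r)).

Definition lattice_Sect (R : realType) (alpha eps r : R) : set (int * int) :=
  [set z | Sect alpha eps r (z.1%:~R, z.2%:~R)].

Lemma finite_lattice_Sect (R : realType) (alpha eps r : R) :
  finite_set (lattice_Sect alpha eps r).
Proof.
pose N := Num.bound `|r|.
have absN (m : int) : m%:~R ^+ 2 <= r ^+ 2 -> (`|m| < N)%N.
  rewrite -[m%:~R ^+ 2]real_normK ?num_real// -[r ^+ 2]real_normK ?num_real//.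
  rewrite ler_pXn2r ?nnegrE// -(ltr_nat R) natr_absz intr_norm => mr.
  exact: le_lt_trans mr (archi_boundP (normr_ge0 _)).
pose B : set int := [set m | (`|m| < N)%N].
have finB : finite_set B.
  apply: (@sub_finite_set _ _ ((Posz @` `I_N) `|` ((fun n => - Posz n) @` `I_N))).
    move=> m /= mN; have [m0|m0] := leP 0 m.
      by left; exists `|m|%N => //; rewrite gez0_abs.
    by right; exists `|m|%N => //; rewrite ltz0_abs// opprK.
  by rewrite finite_setU; split; apply: finite_image.
apply: (sub_finite_set _ (finite_setX finB finB)) => -[m n] [/= _ mnr _ _].
by split; apply: absN; apply: le_trans mnr; rewrite ?lerDl ?lerDr sqr_ge0.
Qed.

Definition lattice_count (R : realType) (alpha eps r : R) : nat :=
  #|` fset_set (lattice_Sect alpha eps r)|%fset.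

(* Main.v *)
Require Import Defs.
From HB Require Import structures.
From mathcomp Require Import all_boot all_order all_algebra finmap.
From mathcomp Require Import all_classical all_reals all_analysis measurable_realfun.
From mathcomp Require Import zify ring lra.
Import Order.TTheory GRing.Theory Num.Theory.
Import numFieldNormedType.Exports.

Local Open Scope classical_set_scope.
Local Open Scope ring_scope.

(** The sector is squeezed between two triangles
    [0 < x <= a, |y - alpha x| < eps x] (called cones below): for points of
    slope within [eps] of [alpha] the squared norm is
    [(1 + alpha^2 + O(eps)) x^2], so truncating by the disc of radius [r]
    amounts, up to a relative error [O(eps)], to truncating at
    [x <= r / sqrt (1 + alpha^2)].  A cone has area [eps a^2], and replacing one
    of the two cones by the other costs [O(r^2 eps^2)].  It remains to count the
    lattice points of a cone with error [O(eps^(1/(1+eta)) r)].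

    Let [p/q] be a reduced fraction with [|q alpha - p| q <= 1].  Cut the
    abscissae into blocks [i q <= m < (i + 1) q].  Inside a block the map
    [(m, n) |-> k = q n - p (m mod q)] is a bijection onto the integers, because
    [p] is invertible modulo [q], and [q (n - alpha m)] differs from
    [k - alpha q^2 i] by at most 1.  Thus the lattice points of the [i]-th block
    are, up to a bounded error, the integers of an interval of half-length
    between [eps q^2 i] and [eps q^2 (i + 1)]; summing over [i] gives
    [eps a^2 + O(eps a q + eps q^2 + a / q + 1)] ([cone_count_le] and
    [cone_count_ge]).

    The optimal [q] would be [eps^(-1/2)], but only some denominators are
    available.  Dirichlet's theorem provides [q <= X] with [|q alpha - p| < 2/X],
    and the type condition forces [q >> X^(1/eta)].  The two errors [eps r X] and
    [r X^(-1/eta)] balance at [X = eps^(-eta/(1+eta))], where both are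
    [eps^(1/(1+eta)) r].  The hypothesis that [eps r^(1+1/eta)] tends to infinity
    is what guarantees [X <= r], so that a block is not longer than the cone. *)

(** * Integers in an interval *)

(** The integers of the open interval of centre [c] and half-length [L], as a
    list; a negative [L] is allowed and gives the empty list. *)
Definition ints_near (R : realType) (c L : R) : seq int :=
  [seq (Num.floor (c - L) + 1 + i%:Z)%R
     | i <- iota 0 (absz (Num.max 0 (Num.ceil (c + L) - (Num.floor (c - L) + 1))))].

Lemma mem_ints_near (R : realType) (c L : R) (k : int) :
  (k \in ints_near R c L) = (`|k%:~R - c| < L).
Proof.
rewrite ltr_distl; apply/mapP/andP => [[i]|[ck kc]].
  rewrite mem_iota => i_lt ->.
  have [lo hi] : Num.floor (c - L) < Num.floor (c - L) + 1 + i%:Z /\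
      Num.floor (c - L) + 1 + i%:Z < Num.ceil (c + L) by lia.
  by rewrite -floor_lt_int lo -ceil_gt_int hi.
have lo : Num.floor (c - L) < k by rewrite floor_lt_int.
have hi : k < Num.ceil (c + L) by rewrite ceil_gt_int.
by exists (absz (k - (Num.floor (c - L) + 1))%R); rewrite ?mem_iota; lia.
Qed.

Lemma ints_near_uniq (R : realType) (c L : R) : uniq (ints_near R c L).
Proof. by rewrite map_inj_uniq ?iota_uniq// => i j; lia. Qed.

(** For [L <= 1/2] the bound is nonpositive: this takes care of the first blocks
    in the lower count of a cone, where the interval may be too narrow to contain
    an integer. *)
Lemma size_ints_near_ge (R : realType) (c L : R) :
  2 * L - 1 <= (size (ints_near R c L))%:R.
Proof.
rewrite size_map size_iota; set n := `|_|%N.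
have : (Num.ceil (c + L) - (Num.floor (c - L) + 1))%:~R <= n%:~R :> R.
  by rewrite ler_int /n; lia.
rewrite -pmulrn !rmorphB/= rmorphD/=.
have := ceil_ge (c + L); have := floor_le (c - L); lra.
Qed.

Lemma size_ints_near_le (R : realType) (c L : R) :
  0 <= L -> (size (ints_near R c L))%:R <= 2 * L + 1.
Proof.
move=> L0; rewrite size_map size_iota; set z := Num.ceil (c + L) - _.
have : z%:~R < 2 * L + 1 :> R.
  rewrite !rmorphB/= rmorphD/=.
  have := ceilB1_lt (c + L); have := floorD1_gt (c - L).
  rewrite rmorphD rmorphB/=; lra.
have [z0|z0] := leP 0 z; last by rewrite absz0; lra.
by move=> zL; rewrite pmulrn gez0_abs// ltW.
Qed.

(** * Block coordinates of a lattice point *)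

(** A lattice point of nonnegative abscissa [m = i q + j], [j < q], is recorded by
    its block [i] and the integer [q n - p j], which is [q] times its height over
    the line of slope [p/q] through [(i q, 0)]. *)
Definition block_coords (p : int) (q : nat) (z : int * int) : nat * int :=
  ((absz z.1 %/ q)%N, q%:Z * z.2 - p * (absz z.1 %% q)%N%:Z).

(** Equal coordinates give [p j = p j'] modulo [q], hence [j = j'] since [p] is
    invertible modulo [q] and both residues are less than [q]. *)
Lemma block_coords_inj (p : int) (q : nat) : (0 < q)%N -> coprimez p q ->
  {in [pred z | 0 <= z.1] &, injective (block_coords p q)}.
Proof.
move=> q0 pq [m n] [m' n']; rewrite !inE/= => m0 m'0 [eqi eqk].
have eqj : (absz m %% q = absz m' %% q)%N.
  have : (q %| p * ((absz m %% q)%N%:Z - (absz m' %% q)%N%:Z))%Z.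
    by apply/dvdzP; exists (n - n'); lia.
  rewrite Gauss_dvdzr; last by rewrite coprimez_sym.
  have := ltn_pmod (absz m) q0; have := ltn_pmod (absz m') q0.
  move: (_ %% _)%N (_ %% _)%N => j j' jq j'q /dvdzP[d] jE.
  have [d1|[d1|d0]] : 1 <= d \/ d <= -1 \/ d = 0 by lia.
  - have : q%:Z <= d * q%:Z by rewrite ler_peMl//.
    by lia.
  - have : q%:Z <= - d * q%:Z by rewrite ler_peMl//; lia.
    by lia.
  - by move: jE; rewrite d0 mul0r; lia.
have eqm : m = m'.
  by have := divn_eq (absz m) q; have := divn_eq (absz m') q; rewrite eqi eqj; lia.
by congr (_, _) => //; move: eqk; rewrite eqj; nia.
Qed.

(** Given [k], the residue is forced to be [j = - p^-1 k] modulo [q], where the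
    inverse [u] of [p] comes from a Bezout relation. *)
Lemma block_coords_surj (p : int) (q : nat) (i : nat) (k : int) :
  (0 < q)%N -> coprimez p q ->
  exists2 z : int * int, 0 <= z.1 & block_coords p q z = (i, k).
Proof.
move=> q0 /coprimezP[[u v]/= uv].
pose j := ((- u * k) %% q)%Z; pose d := ((- u * k) %/ q)%Z.
have jE : - u * k = d * q + j by exact: divz_eq.
have j0 : 0 <= j by apply: modz_ge0; lia.
have jq : j < q by apply: ltz_pmod.
exists ((i * q)%N%:Z + j, v * k - p * d) => /=; first by lia.
rewrite /block_coords/=; have -> : absz ((i * q)%N%:Z + j) = (i * q + absz j)%N by lia.
rewrite divnMDl// modnMDl divn_small ?modn_small; [|lia..].
congr (_, _); first by lia.
rewrite gez0_abs// -[RHS]mul1r -uv.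
have -> : j = - u * k - d * q by lia.
ring.
Qed.

(** The discrepancy between [alpha] and [p/q] accumulates over [j < q] steps
    only, to [(q alpha - p) j]: the second coordinate measures [q (n - alpha m)]
    up to the translation [alpha q^2 i], which depends on the block alone. *)
Lemma block_coords_near (R : realType) (alpha : R) (p : int) (q : nat)
    (z : int * int) :
  (0 < q)%N -> `|q%:R * alpha - p%:~R| * q%:R <= 1 -> 0 <= z.1 ->
  `|(block_coords p q z).2%:~R - alpha * q%:R ^+ 2 * (block_coords p q z).1%:R
    - q%:R * (z.2%:~R - alpha * z.1%:~R)| <= 1.
Proof.
case: z => m n q0 apx /= m0; set j := (_ %% _)%N; set i := (_ %/ _)%N.
have mE : m%:~R = i%:R * q%:R + j%:R :> R.
  by rewrite -natrM -natrD -divn_eq pmulrn gez0_abs.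
rewrite mE rmorphB !rmorphM/= -!pmulrn.
rewrite [X in `|X|](_ : _ = (q%:R * alpha - p%:~R) * j%:R); last by ring.
rewrite normrM (le_trans _ apx)// ler_wpM2l// normr_nat ler_nat.
exact/ltnW/ltn_pmod.
Qed.

(** * Counting the lattice points of a cone *)

Definition cone (R : realType) (alpha eps a : R) : set (R * R) :=
  [set z | z.1 <= a /\ `|z.2 - alpha * z.1| < eps * z.1].

Lemma cone_fst_gt0 (R : realType) (alpha eps a : R) (z : R * R) :
  0 < eps -> cone R alpha eps a z -> 0 < z.1.
Proof.
by move=> eps0 [_ /(le_lt_trans (normr_ge0 _))]; rewrite pmulr_rgt0.
Qed.

Definition blocks (R : realType) (K : nat) (c L : nat -> R) : seq (nat * int) :=
  [seq (i, k) | i <- iota 0 K, k <- ints_near R (c i) (L i)].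

Lemma mem_blocks (R : realType) (K : nat) (c L : nat -> R) (w : nat * int) :
  (w \in blocks R K c L) = (w.1 < K)%N && (`|w.2%:~R - c w.1| < L w.1).
Proof.
case: w => i k /=; apply/allpairsPdep/andP => [[i' [k' [+ + [-> ->]]]]|[iK kL]].
  by rewrite mem_iota mem_ints_near.
by exists i, k; rewrite mem_iota mem_ints_near.
Qed.

Lemma blocks_uniq (R : realType) (K : nat) (c L : nat -> R) :
  uniq (blocks R K c L).
Proof.
apply: allpairs_uniq_dep => [|i _|[i k] [i' k'] _ _ /= [-> ->]//].
- exact: iota_uniq.
- exact: ints_near_uniq.
Qed.

Lemma size_blocks (R : realType) (K : nat) (c L : nat -> R) :
  (size (blocks R K c L))%:R =
  \sum_(0 <= i < K) (size (ints_near R (c i) (L i)))%:R :> R.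
Proof.
by rewrite size_allpairs_dep sumnE big_map natr_sum /index_iota subn0.
Qed.

Lemma sum_affine (R : realType) (K : nat) (u v : R) :
  \sum_(0 <= i < K) (2 * u * i%:R + v) = u * K%:R * (K%:R - 1) + v * K%:R.
Proof.
elim: K => [|K IH]; first by rewrite big_nil; ring.
by rewrite big_nat_recr//= IH -[K.+1%:R]natr1; ring.
Qed.

(** Block coordinates send the points of [A] injectively into blocks of intervals
    of half-length [eps q^2 (i + 1) + 1]: in block [i] the abscissa is less than
    [(i + 1) q], and the 1 absorbs the error of [block_coords_near]. *)
Lemma cone_count_le (R : realType) (alpha eps a : R) (p : int) (q : nat)
    (A : {fset int * int}) :
  0 < eps -> 0 <= a -> (0 < q)%N -> coprimez p q ->
  `|q%:R * alpha - p%:~R| * q%:R <= 1 ->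
  (forall z, z \in A -> cone R alpha eps a (z.1%:~R, z.2%:~R)) ->
  #|` A|%fset%:R <= eps * (a + q%:R) * (a + 2 * q%:R) + 3 * (a / q%:R + 1).
Proof.
move=> eps0 a0 q0 pq apx subA.
have q0R : 0 < q%:R :> R by rewrite ltr0n.
pose K := (Num.truncn (a / q%:R)).+1.
pose c i := alpha * q%:R ^+ 2 * i%:R : R.
pose L i := eps * q%:R ^+ 2 * (i%:R + 1) + 1.
have L0 i : 0 <= L i.
  by rewrite /L addr_ge0// mulr_ge0 ?addr_ge0// mulr_ge0 ?sqr_ge0// ltW.
have A0 z : z \in A -> 0 <= z.1.
  by move=> /subA /(cone_fst_gt0 _ _ _ _ _ eps0); rewrite /= ltr0z; exact: ltW.
have sz : (#|` A|%fset <= size (blocks R K c L))%N.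
  rewrite -(size_map (block_coords p q)); apply: uniq_leq_size.
    rewrite map_inj_in_uniq ?fset_uniq// => z z' zA z'A.
    by apply: (block_coords_inj p q q0 pq); rewrite inE A0.
  move=> w /mapP[z zA ->]; rewrite mem_blocks.
  have [/= za zc] := subA z zA; have z0 := A0 z zA.
  set i := (block_coords p q z).1.
  have [m1 m2] : i%:R * q%:R <= z.1%:~R :> R /\ z.1%:~R < (i%:R + 1) * q%:R :> R.
    have -> : z.1%:~R = (absz z.1)%:R :> R by rewrite pmulrn gez0_abs.
    by rewrite natr1 -!natrM ler_nat ltr_nat leq_divM ltn_ceil.
  apply/andP; split.
    rewrite ltnS truncn_ge_nat ?divr_ge0 ?ler0n// ler_pdivlMr//.
    exact: le_trans m1 za.
  have near := block_coords_near R alpha p q z q0 apx z0.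
  have -> : (block_coords p q z).2%:~R - c i =
      ((block_coords p q z).2%:~R - alpha * q%:R ^+ 2 * i%:R
        - q%:R * (z.2%:~R - alpha * z.1%:~R))
      + q%:R * (z.2%:~R - alpha * z.1%:~R) by rewrite /c; ring.
  apply: le_lt_trans (ler_normD _ _) _; rewrite /L addrC ltr_leD//.
  rewrite normrM ger0_norm ?ler0n// expr2.
  rewrite (_ : _ * (i%:R + 1) = q%:R * (eps * ((i%:R + 1) * q%:R))); last by ring.
  by rewrite ltr_pM2l// (lt_trans zc)// ltr_pM2l.
apply: (@le_trans _ _ ((size (blocks R K c L))%:R)); first by rewrite ler_nat.
rewrite size_blocks.
pose e := eps * q%:R ^+ 2.
apply: (@le_trans _ _ (\sum_(0 <= i < K) (2 * e * i%:R + (2 * e + 3)))).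
  apply: ler_sum => i _; apply: le_trans (size_ints_near_le _ _ _ (L0 i)) _.
  by rewrite /L /e; lra.
rewrite sum_affine.
have Ka : K%:R <= a / q%:R + 1.
  by rewrite -natr1 lerD2r truncn_le divr_ge0// ltW.
have e0 : 0 <= e by rewrite mulr_ge0 ?sqr_ge0 ?ltW.
have -> : eps * (a + q%:R) * (a + 2 * q%:R) =
    e * ((a / q%:R + 1) * (a / q%:R + 2)).
  by rewrite /e; field; rewrite gt_eqF.
have -> : e * K%:R * (K%:R - 1) + (2 * e + 3) * K%:R =
    e * (K%:R * (K%:R + 1)) + 3 * K%:R by ring.
rewrite lerD ?ler_wpM2l//; apply: ler_pM; rewrite ?ler0n ?addr_ge0//; lra.
Qed.

(** Conversely every integer within [eps q^2 i - 1] of [alpha q^2 i] comes from a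
    point of the cone: in block [i] the abscissa is at least [i q].  Only the
    blocks lying entirely below the abscissa [a] are used. *)
Lemma cone_count_ge (R : realType) (alpha eps a : R) (p : int) (q : nat)
    (A : {fset int * int}) :
  0 < eps -> 0 <= a -> (0 < q)%N -> coprimez p q ->
  `|q%:R * alpha - p%:~R| * q%:R <= 1 ->
  (forall z, cone R alpha eps a (z.1%:~R, z.2%:~R) -> z \in A) ->
  eps * (a ^+ 2 - 3 * a * q%:R) - 3 * (a / q%:R) <= #|` A|%fset%:R.
Proof.
move=> eps0 a0 q0 pq apx supA.
have q0R : 0 < q%:R :> R by rewrite ltr0n.
pose K := Num.truncn (a / q%:R).
pose c i := alpha * q%:R ^+ 2 * i%:R : R.
pose L i := eps * q%:R ^+ 2 * i%:R - 1.
have aq0 : 0 <= a / q%:R by rewrite divr_ge0// ltW.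
have sz : (size (blocks R K c L) <= #|` A|%fset)%N.
  rewrite -(size_map (block_coords p q)); apply: uniq_leq_size (blocks_uniq _ _ _ _) _.
  move=> [i k]; rewrite mem_blocks => /andP[/= iK kL].
  have [z z0 zE] := block_coords_surj p q i k q0 pq.
  apply/mapP; exists z => //; apply: supA.
  have near := block_coords_near R alpha p q z q0 apx z0.
  have iE : (absz z.1 %/ q)%N = i by move: zE => [].
  have [m1 m2] : i%:R * q%:R <= z.1%:~R :> R /\ z.1%:~R <= (i%:R + 1) * q%:R :> R.
    have -> : z.1%:~R = (absz z.1)%:R :> R by rewrite pmulrn gez0_abs.
    by rewrite natr1 -!natrM !ler_nat -iE leq_divM ltnW// ltn_ceil.
  split => /=.
    apply: (le_trans m2); rewrite -ler_pdivlMr// natr1.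
    by rewrite -truncn_ge_nat.
  rewrite -(ltr_pM2l q0R) -{1}[q%:R]gtr0_norm// -normrM.
  move: near kL; rewrite zE /= /c /L => near kL.
  apply: (@lt_le_trans _ _ (q%:R * (eps * (i%:R * q%:R)))); last first.
    by rewrite ler_pM2l// ler_pM2l.
  have -> : q%:R * (eps * (i%:R * q%:R)) = eps * q%:R ^+ 2 * i%:R by ring.
  move: near kL; set x := (_ - _ - _) => near kL.
  have -> : q%:R * (z.2%:~R - alpha * z.1%:~R) =
     (k%:~R - alpha * q%:R ^+ 2 * i%:R) - x by rewrite /x; ring.
  by apply: le_lt_trans (ler_normB _ _) _; lra.
apply: (@le_trans _ _ ((size (blocks R K c L))%:R)); last by rewrite ler_nat.
rewrite size_blocks.
pose e := eps * q%:R ^+ 2.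
apply: (@le_trans _ _ (\sum_(0 <= i < K) (2 * e * i%:R + (- 3)))); last first.
  apply: ler_sum => i _; apply: le_trans (size_ints_near_ge _ _ _).
  by rewrite /L /e; lra.
rewrite sum_affine.
have Ka : K%:R <= a / q%:R by rewrite truncn_le.
have aK : a / q%:R < K%:R + 1 by rewrite natr1; have /andP[] := truncn_itv aq0.
have e0 : 0 <= e by rewrite mulr_ge0 ?sqr_ge0 ?ltW.
have -> : eps * (a ^+ 2 - 3 * a * q%:R) =
    e * ((a / q%:R) * (a / q%:R - 3)).
  by rewrite /e; field; rewrite gt_eqF.
rewrite -(mulrA e) lerD ?ler_wpM2l//; last by rewrite mulNr lerN2 ler_wpM2l.
(* When [a / q <= 3] the main term claimed is nonpositive; otherwise
   [K - 1 > a / q - 2 > 0] and the product is bounded below factorwise. *)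
have [aq3|aq3] := leP (a / q%:R) 3.
  apply: (@le_trans _ _ 0); first by rewrite mulr_ge0_le0// subr_le0.
  case: (K) => [|n]; first by rewrite mul0r.
  by rewrite -natr1 addrK mulr_ge0.
by nra.
Qed.

(** * Rational approximation and finite type *)

(** Two of the [N + 1] fractional parts of [i alpha], [0 <= i <= N], lie in the
    same of [N] equal subintervals of [[0, 1)]; subtract the indices. *)
Lemma dirichlet_approx (R : realType) (alpha : R) (N : nat) : (0 < N)%N ->
  exists p : int, exists2 q : nat, (0 < q <= N)%N &
    `|q%:R * alpha - p%:~R| * N%:R < 1.
Proof.
move=> N0; have N0R : 0 < N%:R :> R by rewrite ltr0n.
pose x (i : nat) : R := i%:R * alpha.
pose frac i := N%:R * (x i - (Num.floor (x i))%:~R).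
have frac0 i : 0 <= frac i by rewrite mulr_ge0 ?ler0n// subr_ge0 floor_le.
pose bin i := Num.truncn (frac i).
apply: contrapT => noapx.
suff : (N.+1 <= N)%N by rewrite ltnn.
apply: (@pigeonhole _ _ bin); last first.
  move=> _ [i _ <-] /=; rewrite truncn_lt_nat// /frac -[ltRHS]mulr1.
  by rewrite ltr_pM2l// ltrBlDl -(rmorphD _ _ 1) floorD1_gt.
have sep i j : (i < j <= N)%N -> bin i = bin j -> False.
  move=> /andP[ij jN] eqb; apply: noapx.
  exists (Num.floor (x j) - Num.floor (x i)), (j - i)%N.
    by rewrite subn_gt0 ij (leq_trans (leq_subr _ _) jN).
  rewrite -{1}[N%:R]gtr0_norm// -normrM natrB ?(ltnW ij)// rmorphB/=.
  have -> : ((j%:R - i%:R) * alpha - ((Num.floor (x j))%:~R -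
      (Num.floor (x i))%:~R)) * N%:R = frac j - frac i.
    by rewrite /frac /x; ring.
  have /andP[] := truncn_itv (frac0 i); have /andP[] := truncn_itv (frac0 j).
  by rewrite -/(bin i) -/(bin j) eqb -natr1 ltr_norml => *; lra.
move=> i j; rewrite !inE/= => iN jN eqb.
have [ij|ji|//] := ltngtP i j.
  by case: (sep i j); rewrite ?ij.
by case: (sep j i); rewrite ?ji.
Qed.

(** Dividing [p] and [q] by their gcd only decreases [|q alpha - p|]. *)
Lemma dirichlet_approx_coprime (R : realType) (alpha : R) (N : nat) :
  (0 < N)%N ->
  exists p : int, exists2 q : nat, (0 < q <= N)%N /\ coprimez p q &
    `|q%:R * alpha - p%:~R| * N%:R < 1.
Proof.
move=> /[dup] N0 /(dirichlet_approx R alpha) [p [q /andP[q0 qN] apx]].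
pose d := gcdz p q.
have d0 : 0 < d by rewrite ltz_nat gcdn_gt0 absz_nat q0 orbT.
have qE : q%:Z = (q %/ d)%Z * d by rewrite divzK// dvdz_gcdr.
have pE : p = (p %/ d)%Z * d by rewrite divzK// dvdz_gcdl.
have q'0 : 0 < (q %/ d)%Z by rewrite -(pmulr_lgt0 _ d0) -qE; lia.
have q'q : (q %/ d)%Z <= q by rewrite [leRHS]qE ler_peMr ?(ltW q'0) ?gtz0_ge1.
have absq : Posz (absz (q %/ d)%Z) = (q %/ d)%Z by rewrite gez0_abs// ltW.
exists (p %/ d)%Z, (absz (q %/ d)%Z).
  split; first by lia.
  have gd : gcdz (p %/ d)%Z (q %/ d)%Z * d = 1 * d.
    by rewrite -[X in _ * X = _](gtz0_abs d0) mulz_gcdl -qE -pE mul1r.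
  by rewrite absq /coprimez (mulIf (lt0r_neq0 d0) gd).
apply: le_lt_trans apx; rewrite ler_wpM2r ?ler0n//.
have -> : q%:R * alpha - p%:~R =
    ((absz (q %/ d)%Z)%:R * alpha - (p %/ d)%Z%:~R) * d%:~R :> R.
  rewrite pmulrn {1}qE {1}pE (pmulrn _ (absz _)) absq !rmorphM/=; ring.
rewrite normrM ler_peMr// -(gtz0_abs d0) -pmulrn normr_nat ler1n; lia.
Qed.

Lemma finite_type_dist (R : realType) (alpha eta c : R) (p : int) (q : nat) :
  (0 < q)%N -> `|alpha - p%:~R / q%:R| > c / (q%:R `^ (1 + eta)) ->
  c < `|q%:R * alpha - p%:~R| * q%:R `^ eta.
Proof.
move=> q0; have q0R : 0 < q%:R :> R by rewrite ltr0n.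
have -> : alpha - p%:~R / q%:R = (q%:R * alpha - p%:~R) / q%:R.
  by field; rewrite gt_eqF.
rewrite powRD ?(gt_eqF q0R) ?implybT// powRr1 ?ltW//.
rewrite normrM normfV (gtr0_norm q0R) ltr_pdivrMr ?mulr_gt0 ?powR_gt0//.
by congr (_ < _); field; rewrite gt_eqF.
Qed.

(** A good approximation cannot have a small denominator: finite type gives
    [|q alpha - p| > c / q^eta], while Dirichlet gives [|q alpha - p| < 1 / N].
    Every window [q <= N] thus contains a denominator with [c N < q^eta]. *)
Lemma finite_type_denominators (R : realType) (alpha eta : R) :
  finite_type alpha eta ->
  exists2 c : R, 0 < c & forall N : nat, (0 < N)%N ->
    exists p : int, exists2 q : nat, (0 < q <= N)%N /\ coprimez p q &
      `|q%:R * alpha - p%:~R| * q%:R <= 1 /\ c * N%:R < q%:R `^ eta.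
Proof.
move=> [c c0 fin]; exists c => // N N0.
have [p [q [/andP[q0 qN] pq] apx]] := dirichlet_approx_coprime R alpha N N0.
exists p, q; first by rewrite q0 qN.
have q0R : 0 < q%:R :> R by rewrite ltr0n.
split.
  by apply: le_trans (ltW apx); rewrite ler_wpM2l// ler_nat.
have := fin p q%:Z q0; rewrite -pmulrn => /(finite_type_dist R alpha eta c p q q0).
have qe0 : 0 < q%:R `^ eta by rewrite powR_gt0.
move=> cq; rewrite -[ltRHS]mul1r.
apply: lt_trans (_ : `|q%:R * alpha - p%:~R| * q%:R `^ eta * N%:R < _).
  by rewrite ltr_pM2r ?ltr0n.
by rewrite mulrAC ltr_pM2r.
Qed.

(** The denominators just found satisfy [c N < q^eta <= N^max(eta, 0)] for every
    [N], which fails for large [N] when the exponent is less than 1. *)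
Lemma finite_type_ge1 (R : realType) (alpha eta : R) :
  finite_type alpha eta -> 1 <= eta.
Proof.
move=> /finite_type_denominators[c c0 den]; rewrite leNgt; apply/negP => eta1.
pose s := Num.max eta 0.
have [s0 es s1] : [/\ 0 <= s, eta <= s & s < 1].
  by rewrite /s !le_max !lexx orbT gt_max eta1 ltr01.
have t0 : 0 < 1 - s by rewrite subr_gt0.
(* An integer chosen so that [N^(1 - s) >= 1 / c]. *)
pose N := (Num.truncn (c^-1 `^ (1 - s)^-1)).+1.
have NR0 : 0 < N%:R :> R by rewrite ltr0n.
have cN : c^-1 <= N%:R `^ (1 - s).
  have -> : c^-1 = (c^-1 `^ (1 - s)^-1) `^ (1 - s).
    by rewrite -powRrM mulVf ?gt_eqF// powRr1// invr_ge0 ltW.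
  rewrite ge0_ler_powR ?nnegrE ?powR_ge0 ?ltW//.
  by have /andP[] := truncn_itv (powR_ge0 c^-1 (1 - s)^-1).
have [p [q [/andP[q0 qN] _] [_ cq]]] := den N isT.
have q1 : 1 <= q%:R :> R by rewrite ler1n.
have : q%:R `^ eta <= N%:R `^ s :> R.
  apply: (@le_trans _ _ (q%:R `^ s)); first exact: ler_powR.
  by rewrite ge0_ler_powR ?nnegrE ?ler0n// ler_nat.
move=> /(lt_le_trans cq); apply/negP; rewrite -leNgt.
have NE : N%:R = N%:R `^ (1 - s) * N%:R `^ s :> R.
  by rewrite -powRD ?subrK ?powRr1 ?ltW// gt_eqF// implybT.
rewrite [X in _ <= _ * X]NE mulrA ler_peMl ?powR_ge0//.
by rewrite -ler_pdivrMl// mulr1.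
Qed.

(** * Areas *)

Lemma measurable_Sect (R : realType) (alpha eps r : R) :
  measurable (Sect alpha eps r).
Proof.
have m1 : measurable_fun setT (fun z : R * R => z.1) by exact: measurable_fst.
have m2 : measurable_fun setT (fun z : R * R => z.2) by exact: measurable_snd.
pose b (z : R * R) := [&& 0 < z.1, z.1 ^+ 2 + z.2 ^+ 2 <= r ^+ 2,
  (alpha - eps) * z.1 < z.2 & z.2 < (alpha + eps) * z.1].
have -> : Sect alpha eps r = b @^-1` [set true].
  apply/seteqP; split => [[x y]|[x y]] /=; rewrite /b/=.
    by move=> [x0 ->]; rewrite ltr_pdivlMr// ltr_pdivrMr// x0 => -> ->.
  move=> /and4P[x0 xy lo hi].
  by split => //; rewrite ?ltr_pdivlMr ?ltr_pdivrMr.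
rewrite -[X in measurable X]setTI.
suff mb : measurable_fun setT b by exact: mb.
apply: measurable_and; first exact: measurable_fun_ltr.
apply: measurable_and.
  apply: measurable_fun_ler => //.
  by apply: measurable_funD; apply: measurable_funX.
apply: measurable_and; apply: measurable_fun_ltr => //; exact: measurable_funM.
Qed.

Lemma measurable_cone (R : realType) (alpha eps a : R) :
  measurable (cone R alpha eps a).
Proof.
have m1 : measurable_fun setT (fun z : R * R => z.1) by exact: measurable_fst.
have m2 : measurable_fun setT (fun z : R * R => z.2) by exact: measurable_snd.
pose b (z : R * R) := (z.1 <= a) && (`|z.2 - alpha * z.1| < eps * z.1).
have -> : cone R alpha eps a = b @^-1` [set true].
  by apply/seteqP; split => [[x y]|[x y]] /=; rewrite /b/=;
    [move=> [-> ->]|move=> /andP].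
rewrite -[X in measurable X]setTI.
suff mb : measurable_fun setT b by exact: mb.
apply: measurable_and; first exact: measurable_fun_ler.
apply: measurable_fun_ltr; last exact: measurable_funM.
apply: measurableT_comp => //; apply: measurable_funB => //.
exact: measurable_funM.
Qed.

(** The vertical section at [x] in [[0, a]] is an interval of length
    [2 eps x]. *)
Lemma area_cone (R : realType) (alpha eps a : R) : 0 < eps -> 0 < a ->
  ((@lebesgue_measure R \x @lebesgue_measure R) (cone R alpha eps a) =
   (eps * a ^+ 2)%:E)%E.
Proof.
move=> eps0 a0; rewrite /product_measure1.
rewrite (_ : _%:E = (\int[lebesgue_measure]_(x in `[0%R, a]) (2 * eps * x)%R%:E)%E).
  rewrite [RHS]integral_mkcond; apply: eq_integral => x _; rewrite patchE/=.
  have [xa|xa] := boolP (x \in `[0, a]%classic).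
    move: xa; rewrite inE/= in_itv/= => /andP[x0 xa].
    have -> : xsection (cone R alpha eps a) x =
        `](alpha * x - eps * x), (alpha * x + eps * x)[%classic.
      apply/seteqP; split => y /=; rewrite /xsection/= inE in_itv/= /cone/=.
        by move=> [_]; rewrite ltr_distl.
      by move=> lohi; rewrite ltr_distl.
    rewrite lebesgue_measure_itv/= lte_fin.
    (* The degenerate section at [x = 0] is empty, of length [2 eps 0]. *)
    case: ltP => [_|]; first by rewrite -EFinB; congr _%:E; ring.
    move=> le; congr _%:E; nra.
  rewrite (_ : xsection _ _ = set0) ?measure0//.
  apply/seteqP; split => y //=; rewrite /xsection/= inE => xy.
  have x0 := cone_fst_gt0 _ _ _ _ _ eps0 xy; case: xy => /= xa' _.
  by move: xa; rewrite notin_setE/= in_itv/= => /negP; rewrite (ltW x0) xa'.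
have dF (x : R) : is_derive x (1 : R) (fun y : R => eps * y ^+ 2) (2 * eps * x).
  by apply: is_derive_eq; rewrite /GRing.scale/=; ring.
have cF : continuous (fun y : R => eps * y ^+ 2).
  by move=> x; apply/differentiable_continuous/derivable1_diffP.
rewrite (@continuous_FTC2 _ _ (fun y : R => eps * y ^+ 2))//.
- by rewrite expr0n/= mulr0 sube0.
- by apply: continuous_subspaceT; exact: mulrl_continuous.
- split; first by move=> x _; exact: ex_derive.
  + by apply: cvg_at_right_filter; exact: cF.
  + by apply: cvg_at_left_filter; exact: cF.
- by move=> x _; rewrite derive1E; exact: derive_val.
Qed.

(** * The sector between two cones *)

(** With [t = y - alpha x] the difference is [t (2 alpha x + t)], and
    [|t| < eps x <= x]. *)
Lemma cone_sqnorm (R : realType) (alpha eps x y : R) :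
  0 < eps <= 1 -> `|y - alpha * x| < eps * x ->
  `|x ^+ 2 + y ^+ 2 - (1 + alpha ^+ 2) * x ^+ 2| <=
    eps * (2 * `|alpha| + 1) * x ^+ 2.
Proof.
move=> /andP[eps0 eps1] yx; set t := y - alpha * x in yx.
have x0 : 0 < x.
  by have := le_lt_trans (normr_ge0 _) yx; rewrite pmulr_rgt0.
have -> : x ^+ 2 + y ^+ 2 - (1 + alpha ^+ 2) * x ^+ 2 = t * (2 * alpha * x + t).
  by rewrite /t; ring.
have -> : eps * (2 * `|alpha| + 1) * x ^+ 2 =
    eps * x * (2 * `|alpha| * x + x) by ring.
rewrite normrM ler_pM ?(ltW yx)//; apply: le_trans (ler_normD _ _) _.
rewrite !normrM (gtr0_norm x0) normr_nat lerD2l.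
by rewrite (le_trans (ltW yx))// ler_piMl// ltW.
Qed.

Lemma SectE (R : realType) (alpha eps r : R) (z : R * R) :
  Sect alpha eps r z <->
  [/\ 0 < z.1, z.1 ^+ 2 + z.2 ^+ 2 <= r ^+ 2 &
      `|z.2 - alpha * z.1| < eps * z.1].
Proof.
split => [[x0 zr lo hi]|[x0 zr]].
  split => //; move: lo hi; rewrite ltr_pdivlMr// ltr_pdivrMr// ltr_distl.
  by rewrite mulrBl mulrDl => -> ->.
rewrite ltr_distl -mulrBl -mulrDl => /andP[lo hi].
by split => //; rewrite ?ltr_pdivlMr ?ltr_pdivrMr.
Qed.

Lemma cone_sub_Sect (R : realType) (alpha eps a r : R) :
  0 < eps <= 1 -> 0 <= a ->
  a ^+ 2 * (1 + alpha ^+ 2 + eps * (2 * `|alpha| + 1)) <= r ^+ 2 ->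
  cone R alpha eps a `<=` Sect alpha eps r.
Proof.
move=> /[dup] /andP[eps0 _] eps01 a0 ar z zc; apply/SectE.
have z0 := cone_fst_gt0 R alpha eps a z eps0 zc.
case: zc => za zc; split => //; apply: le_trans ar.
have := cone_sqnorm R alpha eps z.1 z.2 eps01 zc.
rewrite ler_distl => /andP[_ zD].
apply: (le_trans zD); rewrite -mulrDl mulrC ler_wpM2r//.
  by have := normr_ge0 alpha; have := sqr_ge0 alpha; nra.
by rewrite ler_sqr ?nnegrE// ltW.
Qed.

Lemma Sect_sub_cone (R : realType) (alpha eps a r : R) :
  0 < eps <= 1 -> 0 <= a -> eps * (2 * `|alpha| + 1) < 1 + alpha ^+ 2 ->
  r ^+ 2 <= a ^+ 2 * (1 + alpha ^+ 2 - eps * (2 * `|alpha| + 1)) ->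
  Sect alpha eps r `<=` cone R alpha eps a.
Proof.
move=> eps01 a0 D0 ra z /SectE[z0 zr zc]; split => //.
have := cone_sqnorm R alpha eps z.1 z.2 eps01 zc.
rewrite ler_distl => /andP[zD _].
rewrite -ler_sqr ?nnegrE// ?(ltW z0)//.
have := le_trans (le_trans zD zr) ra.
by rewrite -mulrBl mulrC ler_pM2r// subr_gt0.
Qed.

Lemma area_Sect_between (R : realType) (alpha eps a a' r : R) :
  0 < eps -> 0 < a -> 0 < a' ->
  cone R alpha eps a `<=` Sect alpha eps r ->
  Sect alpha eps r `<=` cone R alpha eps a' ->
  eps * a ^+ 2 <= area_Sect alpha eps r <= eps * a' ^+ 2.
Proof.
move=> eps0 a0 a'0 sub sup; rewrite /area_Sect.
set mu := (lebesgue_measure \x lebesgue_measure)%E.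
have lo : ((eps * a ^+ 2)%:E <= mu (Sect alpha eps r))%E.
  rewrite -(area_cone R alpha)//; apply: le_measure => //; rewrite inE.
  - exact: measurable_cone.
  - exact: measurable_Sect.
have hi : (mu (Sect alpha eps r) <= (eps * a' ^+ 2)%:E)%E.
  rewrite -(area_cone R alpha)//; apply: le_measure => //; rewrite inE.
  - exact: measurable_Sect.
  - exact: measurable_cone.
move: lo hi; case: (mu _) => [x||] //=.
by rewrite !lee_fin => -> ->.
Qed.

Lemma mem_lattice_Sect (R : realType) (alpha eps r : R) (z : int * int) :
  z \in fset_set (lattice_Sect alpha eps r) <->
  Sect alpha eps r (z.1%:~R, z.2%:~R).
Proof.
rewrite in_fset_set; last exact: finite_lattice_Sect.
by rewrite inE.
Qed.

(** Take the cones with [a^2 = r^2 / (1 + alpha^2 + eps B)] and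
    [a'^2 = r^2 / (1 + alpha^2 - eps B)].  Both the count and the area are
    squeezed between their values on these two cones, which differ by
    [eps (a'^2 - a^2) = O(r^2 eps^2)] apart from the error terms of the cone
    counts; the latter are simplified using [q <= r] and [a, a' <= 2 r].  The
    condition on [eps B] keeps the denominators away from 0. *)
Lemma lattice_count_area (R : realType) (alpha eps r : R) (p : int) (q : nat) :
  let B := 2 * `|alpha| + 1 in
  0 < eps <= 1 -> eps * B <= 1 / 2 -> (0 < q)%N -> q%:R <= r ->
  coprimez p q -> `|q%:R * alpha - p%:~R| * q%:R <= 1 ->
  `|(lattice_count alpha eps r)%:R - area_Sect alpha eps r| <=
    4 * B * (r ^+ 2 * eps ^+ 2) + 8 * (eps * q%:R * r) + 9 * (r / q%:R).
Proof.
move=> B eps01 epsB q0 qr pq apx; have /andP[eps0 eps1] := eps01.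
have q0R : 0 < q%:R :> R by rewrite ltr0n.
have r0 : 0 < r by exact: lt_le_trans qr.
have B0 : 0 < B by rewrite /B ltr_wpDl// mulr_ge0.
set D := 1 + alpha ^+ 2; have D1 : 1 <= D by rewrite /D lerDl sqr_ge0.
have eB0 : 0 < eps * B by rewrite mulr_gt0.
have dl0 : 0 < D + eps * B by lra.
have dr0 : 1 / 2 <= D - eps * B by lra.
have dr0' : 0 < D - eps * B by lra.
pose a := r / Num.sqrt (D + eps * B); pose a' := r / Num.sqrt (D - eps * B).
have aE : a ^+ 2 = r ^+ 2 / (D + eps * B).
  by rewrite /a expr_div_n sqr_sqrtr// ltW.
have a'E : a' ^+ 2 = r ^+ 2 / (D - eps * B).
  by rewrite /a' expr_div_n sqr_sqrtr// ltW.
have a0 : 0 < a by rewrite /a divr_gt0// sqrtr_gt0.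
have a'0 : 0 < a' by rewrite /a' divr_gt0// sqrtr_gt0.
have sub : cone R alpha eps a `<=` Sect alpha eps r.
  by apply: cone_sub_Sect => //; rewrite ?(ltW a0)// aE -/B -/D divfK ?gt_eqF.
have sup : Sect alpha eps r `<=` cone R alpha eps a'.
  apply: Sect_sub_cone => //; rewrite ?(ltW a'0)// -/B -/D ?a'E ?divfK ?gt_eqF//.
  by rewrite -subr_gt0.
have aa' : a' ^+ 2 - a ^+ 2 <= 4 * B * r ^+ 2 * eps.
  have -> : a' ^+ 2 - a ^+ 2 =
      2 * B * r ^+ 2 * eps * ((D + eps * B) * (D - eps * B))^-1.
    by rewrite aE a'E; field; rewrite !gt_eqF.
  have -> : 4 * B * r ^+ 2 * eps = 2 * B * r ^+ 2 * eps * 2 by ring.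
  apply: ler_wpM2l.
    by rewrite mulr_ge0 ?(ltW eps0)// mulr_ge0 ?sqr_ge0// mulr_ge0 ?(ltW B0).
  rewrite -[leRHS]invrK lef_pV2 ?posrE ?invr_gt0 ?mulr_gt0//.
  by nra.
have a'2 : a' <= 2 * r.
  have r20 : 0 <= 2 * r by rewrite mulr_ge0 ?(ltW r0).
  rewrite -ler_sqr ?nnegrE ?(ltW a'0)// a'E ler_pdivrMr//.
  by have := sqr_ge0 r; nra.
have aa : a <= a'.
  rewrite -ler_sqr ?nnegrE ?(ltW a0) ?(ltW a'0)// aE a'E ler_pM2l ?exprn_gt0//.
  by rewrite lef_pV2 ?posrE//; lra.
have /andP[area_ge area_le] :=
  area_Sect_between R alpha eps a a' r eps0 a0 a'0 sub sup.
pose A := fset_set (lattice_Sect alpha eps r).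
have count_le : (lattice_count alpha eps r)%:R <=
    eps * (a' + q%:R) * (a' + 2 * q%:R) + 3 * (a' / q%:R + 1).
  apply: (cone_count_le R alpha eps a' p q A) => //; first exact: ltW.
  by move=> z /mem_lattice_Sect; exact: sup.
have count_ge : eps * (a ^+ 2 - 3 * a * q%:R) - 3 * (a / q%:R) <=
    (lattice_count alpha eps r)%:R.
  apply: (cone_count_ge R alpha eps a p q A) => //; first exact: ltW.
  by move=> z /sub /mem_lattice_Sect.
have eaa' : eps * a' ^+ 2 - eps * a ^+ 2 <= 4 * B * (r ^+ 2 * eps ^+ 2).
  rewrite -mulrBr (_ : 4 * B * _ = eps * (4 * B * r ^+ 2 * eps)); last by ring.
  by rewrite ler_pM2l.
have a'q : a' / q%:R <= 2 * (r / q%:R) by rewrite mulrA ler_pM2r ?invr_gt0.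
have aq : a / q%:R <= 2 * (r / q%:R).
  by apply: le_trans a'q; rewrite ler_pM2r ?invr_gt0.
have rq : 1 <= r / q%:R by rewrite ler_pdivlMr ?mul1r.
have ea'q : eps * (a' * q%:R) <= 2 * (eps * q%:R * r).
  have -> : 2 * (eps * q%:R * r) = eps * ((2 * r) * q%:R) by ring.
  by rewrite ler_pM2l// ler_pM2r.
have eaq : eps * (a * q%:R) <= 2 * (eps * q%:R * r).
  by apply: le_trans ea'q; rewrite ler_pM2l// ler_pM2r.
have eqq : eps * q%:R * q%:R <= eps * q%:R * r by rewrite ler_pM2l ?mulr_gt0.
have eqr0 : 0 <= eps * q%:R * r by rewrite !mulr_ge0// ltW.
rewrite ler_norml; apply/andP; split; lra.
Qed.

(** * Choice of the denominator *)

Lemma one_powR (R : realType) (x : R) : (1 : R) `^ x = 1.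
Proof. by rewrite powR1. Qed.

(** Think of [w] as [eps^(1/(1+eta))], so that [eps = w w^eta] and the optimal
    [X] is [w^(-eta)].  The denominator [q <= X] satisfies [X << q^eta], that is
    [1 / q << w], while [q w^eta <= 1] says that [eps q <= w]: the two errors
    [eps q r] and [r / q] are both [O(w r)]. *)
Lemma balanced_denominator (R : realType) (alpha eta c w r : R) :
  0 < c -> 1 <= eta -> 0 < w <= 1 -> 1 <= w `^ eta * r ->
  (forall N : nat, (0 < N)%N ->
    exists p : int, exists2 q : nat, (0 < q <= N)%N /\ coprimez p q &
      `|q%:R * alpha - p%:~R| * q%:R <= 1 /\ c * N%:R < q%:R `^ eta) ->
  exists p : int, exists2 q : nat, (0 < q)%N /\ coprimez p q &
    [/\ `|q%:R * alpha - p%:~R| * q%:R <= 1, q%:R * w `^ eta <= 1, q%:R <= r &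
        q%:R^-1 <= (c / 2) `^ (- eta^-1) * w].
Proof.
move=> c0 eta1 /andP[w0 w1] wr den.
have eta0 : 0 < eta by exact: lt_le_trans eta1.
set u := w `^ eta; have u0 : 0 < u by rewrite powR_gt0.
have u1 : 1 <= u^-1.
  by rewrite invf_ge1// -(one_powR R eta) ge0_ler_powR ?nnegrE ?(ltW eta0) ?(ltW w0).
set N := Num.truncn u^-1.
have N0 : (0 < N)%N by rewrite truncn_gt0.
have NR1 : 1 <= N%:R :> R by rewrite ler1n.
have /andP[Nu uN] := truncn_itv (le_trans ler01 u1).
have [p [q [/andP[q0 qN] pq] [apx cq]]] := den N N0.
have q0R : 0 < q%:R :> R by rewrite ltr0n.
have qu : q%:R <= u^-1 by rewrite (le_trans _ Nu)// ler_nat.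
exists p, q; split => //.
- by rewrite -ler_pdivlMr// div1r.
- by rewrite (le_trans qu)// -[u^-1]mul1r ler_pdivrMr// mulrC.
have c20 : 0 < c / 2 by rewrite divr_gt0.
rewrite powRN -[w in _ * w]invrK -invfM lef_pV2 ?posrE ?mulr_gt0 ?powR_gt0 ?invr_gt0//.
have -> : w^-1 = (u^-1) `^ eta^-1.
  rewrite /u -powRN -powRrM mulNr mulfV ?gt_eqF//.
  by rewrite powR_inv1// ltW.
have cu0 : 0 <= c / 2 / u by rewrite divr_ge0 ?(ltW c20) ?(ltW u0).
have ui0 : 0 <= u^-1 by rewrite invr_ge0 ltW.
rewrite -powRM ?(ltW c20)//.
have -> : q%:R = (q%:R `^ eta) `^ eta^-1 :> R.
  by rewrite -powRrM mulfV ?gt_eqF// powRr1 ?(ltW q0R).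
rewrite ge0_ler_powR ?nnegrE ?powR_ge0 ?invr_ge0 ?(ltW eta0)//.
apply: le_trans (ltW cq).
have -> : c / 2 / u = c * (u^-1 / 2) by ring.
rewrite ler_pM2l// ler_pdivrMr//.
move: uN; rewrite -/N -natr1; lra.
Qed.

(** * The asymptotic count *)

Theorem theorem1p3 (R : realType) (alpha eta : R) (eps : R -> R)
  (alpha_irr : irrational alpha)
  (alpha_type : finite_type alpha eta)
  (eps_gt0 : forall r : R, 0 < r -> 0 < eps r)
  (eps_cvg0 : eps r @[r --> +oo] --> 0)
  (eps_cvgy : eps r * r `^ (1 + 1 / eta) @[r --> +oo] --> +oo) :
  exists2 C : R, 0 < C &
    \forall r \near +oo,
      `|(lattice_count alpha (eps r) r)%:R - area_Sect alpha (eps r) r|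
      <= C * (eps r `^ (1 / (1 + eta)) * r + r ^+ 2 * eps r ^+ 2).
Proof.
have eta1 := finite_type_ge1 R alpha eta alpha_type.
have eta0 : 0 < eta by exact: lt_le_trans eta1.
have [c c0 den] := finite_type_denominators R alpha eta alpha_type.
pose B := 2 * `|alpha| + 1.
have B0 : 0 < B by rewrite /B ltr_wpDl// mulr_ge0.
pose k := (c / 2) `^ (- eta^-1).
have k0 : 0 <= k by exact: powR_ge0.
exists (4 * B + 8 + 9 * k).
  by rewrite ltr_wpDr ?mulr_ge0// ltr_wpDr// mulr_gt0.
pose e0 := Num.min 1 (1 / 2 / B).
have e00 : 0 < e0 by rewrite lt_min ltr01 !divr_gt0.
have eps_small : \forall r \near +oo, `|eps r| < e0.
  by move/cvgr0_norm_lt : eps_cvg0; apply.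
have eps_big : \forall r \near +oo, 1 <= eps r * r `^ (1 + 1 / eta).
  by move/cvgryPge : eps_cvgy; apply.
near=> r.
have r1 : 1 <= r by near: r; exact: nbhs_pinfty_ge.
have r0 : 0 < r by exact: lt_le_trans r1.
have e_gt0 := eps_gt0 r r0.
have [e1 eB] : eps r <= 1 /\ eps r * B <= 1 / 2.
  have : `|eps r| < e0 by near: r.
  rewrite gtr0_norm// lt_min => /andP[e1 eB]; split; first exact: ltW.
  by rewrite -ler_pdivlMr// ltW.
have eb : 1 <= eps r * r `^ (1 + 1 / eta) by near: r.
set e := eps r in e_gt0 e1 eB eb *.
have D0 : 0 < 1 + eta by rewrite addr_gt0.
pose w := e `^ (1 / (1 + eta)).
have w0 : 0 < w by rewrite powR_gt0.
have w1 : w <= 1.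
  by rewrite -[leRHS](one_powR R (1 / (1 + eta))) ge0_ler_powR ?nnegrE
    ?divr_ge0 ?(ltW D0) ?(ltW e_gt0).
have ew : e = w * w `^ eta.
  rewrite -{1}(powRr1 (ltW w0)) -powRD ?gt_eqF ?implybT//.
  by rewrite /w -powRrM mul1r mulVf ?gt_eqF// powRr1// ltW.
(* This is [1 <= eps r^(1+1/eta)] raised to the power [eta / (1 + eta)]. *)
have wr : 1 <= w `^ eta * r.
  have : 1 <= (e * r `^ (1 + 1 / eta)) `^ (eta / (1 + eta)).
    rewrite -[leLHS](one_powR R (eta / (1 + eta))) ge0_ler_powR ?nnegrE//.
    - by rewrite divr_ge0 ?ltW.
    - by rewrite mulr_ge0 ?powR_ge0 ?(ltW e_gt0).
  rewrite powRM ?powR_ge0 ?(ltW e_gt0)// /w -!powRrM.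
  have -> : (1 + 1 / eta) * (eta / (1 + eta)) = 1 by field; rewrite !gt_eqF.
  by rewrite powRr1 ?(ltW r0)// mul1r (mulrC _ eta).
have w01 : 0 < w <= 1 by rewrite w0 w1.
have [p [q [q0 pq] [apx qw qr qinv]]] :=
  balanced_denominator R alpha eta c w r c0 eta1 w01 wr den.
have e01 : 0 < e <= 1 by rewrite e_gt0 e1.
have := lattice_count_area R alpha e r p q e01 eB q0 qr pq apx.
move=> /le_trans; apply; rewrite -/B.
have eqr : e * q%:R * r <= w * r.
  rewrite ler_pM2r// ew -mulrA ler_piMr ?(ltW w0)// mulrC//.
have rq : r / q%:R <= k * (w * r).
  by rewrite mulrA mulrC ler_pM2r.
have s0 : 0 <= r ^+ 2 * e ^+ 2 by rewrite mulr_ge0 ?sqr_ge0.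
have wr0 : 0 <= w * r by rewrite mulr_ge0 ?ltW.
rewrite -/w.
have := mulr_ge0 (ltW B0) wr0; have := mulr_ge0 k0 s0.
rewrite !mulrDl !mulrDr; lra.
Unshelve. all: by end_near.
Qed.
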